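(* For every wide Aronszajn tree $T$ there is a ccc forcing notion $\mathbb P=\mathbb P(T)$ and a family $\mathcal H$ of $\aleph_1$ many dense subsets of $\mathbb P$ such that every filter $G\subseteq\mathbb P$ meeting all members of $\mathcal H$ yields an Aronszajn tree $T^\ast$ into which $T$ weakly embeds. In particular, assuming $MA(\omega_1)$, every wide Aronszajn tree weakly embeds into some Aronszajn tree (the Aronszajn trees are cofinal in the class of wide Aronszajn trees under weak embeddability).
   Context: A wide Aronszajn tree is a tree of height $\omega_1$ and cardinality $\aleph_1$ with no uncountable branch (levels may be uncountable). An Aronszajn tree is a tree of height $\omega_1$ with all levels countable and no uncountable branch. A weak embedding from $T_1$ to $T_2$ is a map $f:T_1\to T_2$ such that $x<_{T_1}y\Rightarrow f(x)<_{T_2}f(y)$. $MA(\omega_1)$ is Martin's Axiom for $\aleph_1$ dense sets. *)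

(* Defs.v *)
Definition countable {X : Type} (A : X -> Prop) : Prop :=
  exists f : X -> nat, forall x y, A x -> A y -> f x = f y -> x = y.

Definition is_omega1 (W : Type) (ltW : W -> W -> Prop) : Prop :=
  (forall a, ~ ltW a a) /\
  (forall a b c, ltW a b -> ltW b c -> ltW a c) /\
  (forall a b, a = b \/ ltW a b \/ ltW b a) /\
  well_founded ltW /\
  ~ countable (fun _ : W => True) /\
  (forall a, countable (fun b => ltW b a)).

Definition is_tree (T : Type) (ltT : T -> T -> Prop) : Prop :=
  (forall t, ~ ltT t t) /\
  (forall r s t, ltT r s -> ltT s t -> ltT r t) /\
  (forall t s1 s2, ltT s1 t -> ltT s2 t -> s1 = s2 \/ ltT s1 s2 \/ ltT s2 s1).

(* lev is the height (level) function of a tree of height omega_1: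
   it is strictly monotone, the predecessors of t are mapped onto the initial
   segment below lev t (so lev t is the order type of the predecessors of t),
   and every level alpha < omega_1 is nonempty. *)
Definition is_level_fn (W : Type) (ltW : W -> W -> Prop)
  (T : Type) (ltT : T -> T -> Prop) (lev : T -> W) : Prop :=
  (forall s t, ltT s t -> ltW (lev s) (lev t)) /\
  (forall t a, ltW a (lev t) -> exists s, ltT s t /\ lev s = a) /\
  (forall a, exists t, lev t = a).

Definition chain {T : Type} (ltT : T -> T -> Prop) (B : T -> Prop) : Prop :=
  forall x y, B x -> B y -> x = y \/ ltT x y \/ ltT y x.

Definition branch {T : Type} (ltT : T -> T -> Prop) (B : T -> Prop) : Prop :=
  chain ltT B /\ (forall C, chain ltT C -> (forall x, B x -> C x) -> forall x, C x -> B x).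

Definition no_uncountable_branch {T : Type} (ltT : T -> T -> Prop) : Prop :=
  forall B, branch ltT B -> countable B.

Definition wide_aronszajn (W : Type) (ltW : W -> W -> Prop)
  (T : Type) (ltT : T -> T -> Prop) : Prop :=
  is_tree T ltT /\
  (exists lev : T -> W, is_level_fn W ltW T ltT lev) /\
  (exists f : T -> W, (forall x y, f x = f y -> x = y) /\ (forall a, exists x, f x = a)) /\
  no_uncountable_branch ltT.

Definition aronszajn (W : Type) (ltW : W -> W -> Prop)
  (T : Type) (ltT : T -> T -> Prop) : Prop :=
  is_tree T ltT /\
  (exists lev : T -> W, is_level_fn W ltW T ltT lev /\
     forall a, countable (fun t => lev t = a)) /\
  no_uncountable_branch ltT.

Definition weak_embedding {T1 T2 : Type} (lt1 : T1 -> T1 -> Prop)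
  (lt2 : T2 -> T2 -> Prop) (f : T1 -> T2) : Prop :=
  forall x y, lt1 x y -> lt2 (f x) (f y).

(* Forcing notions: nonempty preorders, p <= q meaning p is stronger. *)
Definition forcing_notion (P : Type) (le : P -> P -> Prop) : Prop :=
  inhabited P /\ (forall p, le p p) /\ (forall p q r, le p q -> le q r -> le p r).

Definition compatible {P : Type} (le : P -> P -> Prop) (p q : P) : Prop :=
  exists r, le r p /\ le r q.

Definition antichain {P : Type} (le : P -> P -> Prop) (A : P -> Prop) : Prop :=
  forall p q, A p -> A q -> p <> q -> ~ compatible le p q.

Definition ccc {P : Type} (le : P -> P -> Prop) : Prop :=
  forall A, antichain le A -> countable A.

Definition dense {P : Type} (le : P -> P -> Prop) (D : P -> Prop) : Prop :=
  forall p, exists q, D q /\ le q p.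

Definition filter {P : Type} (le : P -> P -> Prop) (G : P -> Prop) : Prop :=
  (exists p, G p) /\
  (forall p q, G p -> le p q -> G q) /\
  (forall p q, G p -> G q -> exists r, G r /\ le r p /\ le r q).

Definition MA_omega1 (W : Type) (ltW : W -> W -> Prop) : Prop :=
  forall (P : Type) (le : P -> P -> Prop),
    forcing_notion P le -> ccc le ->
    forall D : W -> P -> Prop, (forall a, dense le (D a)) ->
    exists G, filter le G /\ forall a, exists p, G p /\ D a p.

(* Main.v *)
(** Call [e : T -> nat] a coherent specialization if it is injective on chains
    and, for [x], [y] on the same level with [e x = e y], the predecessors of
    [x] and [y] on each lower level also have equal [e]-values.  Identifying
    nodes with the same level and the same [e]-value then gives a tree with
    countable levels that is still specialized by [e], hence Aronszajn, and the
    quotient map is a level-preserving weak embedding.  The forcing adds such an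
    [e] by finite approximations.  For the ccc, an uncountable family of
    conditions closed under restriction to their own levels is thinned until
    every coordinate is constant or countable-to-one; two such conditions
    amalgamate unless a node of one, on a level outside the root, lies below a
    node of the other, and if this always happens, a uniform ultrafilter on the
    family produces an uncountable chain of [T]. *)

From Stdlib Require Import Classical ClassicalEpsilon ProofIrrelevance.
From Stdlib Require Import List Lia Cantor.
From mathcomp Require filter.
Require Import Defs.
Import ListNotations.

(** * Countable sets and uniform ultrafilters *)

Lemma countable_sub {X : Type} (A B : X -> Prop) :
  (forall x, A x -> B x) -> countable B -> countable A.
Proof. intros AB [f Hf]; exists f; auto. Qed.

Lemma countable_bigcup {I X : Type} (D : I -> Prop) (S : I -> X -> Prop) :
  countable D -> (forall i, D i -> countable (S i)) ->
  countable (fun x => exists i, D i /\ S i x).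
Proof.
intros [f Hf] HS.
destruct (classic (inhabited I)) as [[i0]|nI].
2: { exists (fun _ => 0); intros x y [i _]; destruct (nI (inhabits i)). }
pose (g := fun i => epsilon (inhabits (fun _ : X => 0))
  (fun h => forall x y, S i x -> S i y -> h x = h y -> x = y)).
assert (Hg : forall i, D i -> forall x y, S i x -> S i y -> g i x = g i y -> x = y).
{ intros i Di; exact (epsilon_spec _ _ (HS i Di)). }
pose (k := fun x => epsilon (inhabits i0) (fun i => D i /\ S i x)).
exists (fun x => Cantor.to_nat (f (k x), g (k x) x)).
intros x y Hx Hy E.
assert (Kx : D (k x) /\ S (k x) x) by exact (epsilon_spec _ _ Hx).
assert (Ky : D (k y) /\ S (k y) y) by exact (epsilon_spec _ _ Hy).
destruct Kx as [Dx Sx]; destruct Ky as [Dy Sy].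
apply Cantor.to_nat_inj in E; injection E as E1 E2.
apply Hf in E1; auto.
rewrite E1 in Sx, E2; exact (Hg _ Dy _ _ Sx Sy E2).
Qed.

Lemma countable_list {X : Type} (l : list X) : countable (fun x => In x l).
Proof.
pose (k := fun x => epsilon (inhabits 0) (fun n => nth_error l n = Some x)).
exists k; intros x y Hx Hy E.
apply In_nth_error in Hx; apply In_nth_error in Hy.
apply (epsilon_spec (inhabits 0)) in Hx; apply (epsilon_spec (inhabits 0)) in Hy.
fold (k x) in Hx; fold (k y) in Hy; congruence.
Qed.

Lemma countable_eq {X : Type} (a : X) : countable (fun x => x = a).
Proof. exists (fun _ => 0); congruence. Qed.

Lemma countable_union {X : Type} (A B : X -> Prop) :
  countable A -> countable B -> countable (fun x => A x \/ B x).
Proof.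
intros HA HB.
apply countable_sub with
  (fun x => exists b : bool, True /\ (if b then A x else B x)).
{ intros x [H|H]; [exists true|exists false]; auto. }
apply countable_bigcup.
- exists (fun b : bool => if b then 0 else 1); intros [] []; congruence.
- intros []; auto.
Qed.

Lemma countable_preimage {X Y : Type} (A : X -> Prop) (g : X -> Y) (B : Y -> Prop) :
  countable B -> (forall y, B y -> countable (fun x => A x /\ g x = y)) ->
  countable (fun x => A x /\ B (g x)).
Proof.
intros HB HS.
apply countable_sub with (fun x => exists y, B y /\ (A x /\ g x = y)).
{ intros x [Ax Bx]; exists (g x); auto. }
now apply countable_bigcup.
Qed.

Lemma uncountable_pair {X : Type} (A : X -> Prop) :
  ~ countable A -> exists x y, A x /\ A y /\ x <> y.
Proof.
intros nA; apply NNPP; intros H; apply nA.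
exists (fun _ => 0); intros x y Ax Ay _.
apply NNPP; intros ne; apply H; eauto.
Qed.

(** Indices are treated one at a time: if some fibre of [g i] is uncountable, the set shrinks to
    that fibre; otherwise all fibres are countable. Both alternatives survive later shrinking. *)
Lemma thin_family {I X Y : Type} (g : I -> X -> Y) (l : list I) (A : X -> Prop) :
  ~ countable A ->
  exists B : X -> Prop, (forall x, B x -> A x) /\ ~ countable B /\
    forall i, In i l ->
      (exists y, forall x, B x -> g i x = y) \/
      (forall y, countable (fun x => B x /\ g i x = y)).
Proof.
intros nA; induction l as [|i l [B [BA [nB HB]]]].
{ exists A; repeat split; auto; intros i []. }
destruct (classic (exists y, ~ countable (fun x => B x /\ g i x = y)))
  as [[y Hy]|nE].
- exists (fun x => B x /\ g i x = y); repeat split; auto.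
  { intros x []; auto. }
  intros j [<-|Hj].
  { left; exists y; intros x []; auto. }
  destruct (HB j Hj) as [[z Hz]|Hz].
  + left; exists z; intros x []; auto.
  + right; intros z; apply countable_sub with (2 := Hz z); tauto.
- exists B; repeat split; auto.
  intros j [<-|Hj]; auto.
  right; intros y; apply NNPP; intros ny; apply nE; now exists y.
Qed.

(** With values in [nat], the countable-to-one alternative would make [B] a countable union of
    countable sets. *)
Lemma thin_family_nat {I X : Type} (g : I -> X -> nat) (l : list I) (A : X -> Prop) :
  ~ countable A ->
  exists B : X -> Prop, (forall x, B x -> A x) /\ ~ countable B /\
    forall i x y, In i l -> B x -> B y -> g i x = g i y.
Proof.
intros nA; destruct (thin_family g l A nA) as [B [BA [nB HB]]].
exists B; repeat split; auto.
intros i x y Hi Bx By; destruct (HB i Hi) as [[z Hz]|Hz].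
- now rewrite Hz, Hz.
- exfalso; apply nB.
  apply countable_sub with (fun x => B x /\ (fun _ => True) (g i x)); auto.
  apply (countable_preimage B (g i) (fun _ => True)); auto.
  exists (fun n => n); auto.
Qed.

(** Extends the filter of sets that miss only countably many points of [A], which is proper because
    [A] is uncountable. The last clause is the primeness of an ultrafilter, for finite unions. *)
Lemma uniform_ultrafilter {X : Type} (A : X -> Prop) :
  ~ countable A ->
  exists U : (X -> Prop) -> Prop,
    (forall S, countable (fun x => A x /\ ~ S x) -> U S) /\
    (forall S S', U S -> U S' -> exists x, S x /\ S' x /\ A x) /\
    (forall (I : Type) (l : list I) (S : I -> X -> Prop),
       U (fun x => exists i, In i l /\ S i x) -> exists i, In i l /\ U (S i)).
Proof.
intros nA.
pose (F := fun S : X -> Prop => countable (fun x => A x /\ ~ S x)).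
assert (PF : filter.ProperFilter F).
{ constructor.
  - intros H; apply nA; apply countable_sub with (2 := H); intros x Ax; split; auto.
  - constructor.
    + exists (fun _ => 0); intros x y [_ H]; destruct (H Logic.I).
    + intros S S' H H'; apply countable_sub with (2 := countable_union _ _ H H').
      intros x [Ax nS]; destruct (classic (S x)).
      * right; split; auto; intros S'x; now apply nS.
      * left; auto.
    + intros S S' SS' H; apply countable_sub with (2 := H).
      intros x [Ax nS]; split; auto. }
destruct (filter.ultraFilterLemma PF) as [U [UU FU]].
assert (UI : forall S S', U S -> U S' -> U (fun x => S x /\ S' x)).
{ exact (@filter.filterI _ U _). }
assert (US : forall S S' : X -> Prop, (forall x, S x -> S' x) -> U S -> U S').
{ exact (@filter.filterS _ U _). }
assert (U0 : forall S : X -> Prop, (forall x, ~ S x) -> ~ U S).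
{ intros S nS HS; apply (filter.filter_not_empty U).
  apply US with (2 := HS); intros x Sx; destruct (nS x Sx). }
exists U; split; [exact FU|split].
- intros S S' HS HS'; apply NNPP; intros nE.
  apply (U0 (fun x => (S x /\ S' x) /\ A x)).
  + intros x [[Sx S'x] Ax]; apply nE; eauto.
  + apply UI; auto; apply FU.
    exists (fun _ => 0); intros x y [Ax nx]; destruct (nx Ax).
- intros I l S; induction l as [|i l IH]; intros H.
  + exfalso; refine (U0 _ _ H); intros x [i [[] _]].
  + destruct (filter.in_ultra_setVsetC (S i) UU) as [H'|H'].
    * exists i; split; auto; now left.
    * destruct IH as [j [Hj Uj]]; [|exists j; split; auto; now right].
      apply US with (2 := UI _ _ H H').
      intros x [[j [[<-|Hj] Sj]] nS]; [destruct (nS Sj)|eauto].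
Qed.

(** * The forcing *)

Section Forcing.
Context {W : Type} {ltW : W -> W -> Prop} (omega1W : is_omega1 W ltW).
Context {T : Type} {ltT : T -> T -> Prop} (treeT : is_tree T ltT).
Context {lev : T -> W} (levT : is_level_fn W ltW T ltT lev).

Lemma ltW_irrefl a : ~ ltW a a.
Proof. apply omega1W. Qed.

Lemma ltW_trans a b c : ltW a b -> ltW b c -> ltW a c.
Proof. apply omega1W. Qed.

Lemma ltW_asym a b : ltW a b -> ~ ltW b a.
Proof. intros ab ba; exact (ltW_irrefl _ (ltW_trans _ _ _ ab ba)). Qed.

Lemma lev_lt s t : ltT s t -> ltW (lev s) (lev t).
Proof. apply levT. Qed.

Lemma ltT_trans r s t : ltT r s -> ltT s t -> ltT r t.
Proof. apply treeT. Qed.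

Lemma pred_unique s s' t : ltT s t -> ltT s' t -> lev s = lev s' -> s = s'.
Proof.
intros st s't E; destruct treeT as [_ [_ lin]].
destruct (lin t s s' st s't) as [|[H|H]]; auto; exfalso;
  apply lev_lt in H; rewrite E in H; exact (ltW_irrefl _ H).
Qed.

Lemma pred_lt s s' t : ltT s t -> ltT s' t -> ltW (lev s) (lev s') -> ltT s s'.
Proof.
intros st s't E; destruct treeT as [_ [_ lin]].
destruct (lin t s s' st s't) as [<-|[H|H]]; auto; exfalso.
- exact (ltW_irrefl _ E).
- apply lev_lt in H; exact (ltW_asym _ _ E H).
Qed.

Lemma pred_transfer s t t' :
  ltT s t -> lev t = lev t' -> exists s', ltT s' t' /\ lev s' = lev s.
Proof.
intros st E; apply levT; rewrite <- E; now apply lev_lt.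
Qed.

Lemma countable_not_above a : countable (fun b => ~ ltW a b).
Proof.
destruct omega1W as [_ [_ [tri [_ [_ cnt]]]]].
apply countable_sub with (fun b => b = a \/ ltW b a).
{ intros b nb; destruct (tri a b) as [|[|]]; auto; contradiction. }
apply countable_union; [apply countable_eq|apply cnt].
Qed.

(** The hypothesis speaks only of maximal chains. Zorn's lemma is avoided: if [K] is uncountable,
    its downward closure is already maximal, since the levels of [K] are unbounded. *)
Lemma countable_chain (nb : no_uncountable_branch ltT) (K : T -> Prop) :
  chain ltT K -> countable K.
Proof.
intros chK; apply NNPP; intros nK; apply nK.
destruct treeT as [_ [_ lin]].
pose (D := fun x => exists c, K c /\ (x = c \/ ltT x c)).
apply countable_sub with D; [intros x Kx; exists x; auto|].
apply nb; split.
- intros x y [c [Kc xc]] [d [Kd yd]].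
  destruct (chK c d Kc Kd) as [<-|[cd|dc]].
  + destruct xc as [->|xc], yd as [->|yd]; auto; exact (lin _ _ _ xc yd).
  + assert (xd : ltT x d) by (destruct xc as [->|xc]; eauto using ltT_trans).
    destruct yd as [->|yd]; auto; exact (lin _ _ _ xd yd).
  + assert (yc : ltT y c) by (destruct yd as [->|yd]; eauto using ltT_trans).
    destruct xc as [->|xc]; auto; exact (lin _ _ _ xc yc).
- intros C chC DC e Ce.
  destruct (classic (exists c, K c /\ ltW (lev e) (lev c))) as [[c [Kc ec]]|nE].
  + exists c; split; auto.
    assert (Cc : C c) by (apply DC; exists c; auto).
    destruct (chC e c Ce Cc) as [|[|H]]; auto.
    exfalso; exact (ltW_asym _ _ ec (lev_lt _ _ H)).
  (* Otherwise [K] lives on the countably many levels not above [lev e], and a chain has at most one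
     node on each level. *)
  + exfalso; apply nK.
    apply countable_sub with (fun x => K x /\ ~ ltW (lev e) (lev x)).
    { intros x Kx; split; auto; intros H; apply nE; eauto. }
    apply (countable_preimage K lev (fun b => ~ ltW (lev e) b)).
    { apply countable_not_above. }
    intros a _; exists (fun _ => 0); intros x y [Kx <-] [Ky E] _.
    destruct (chK x y Kx Ky) as [|[H|H]]; auto; exfalso;
      apply lev_lt in H; rewrite E in H; exact (ltW_irrefl _ H).
Qed.

(* Only the labels on [dom] are the condition's information.  The total labelling
   [lab] merely witnesses that they extend to the missing predecessors of [dom];
   this avoids having to keep [dom] closed under restriction. *)
Record cond := Cond {
  dom : list T;
  lab : T -> nat;
  lab_bound : exists N, forall t, lab t < N;
  lab_chain : forall s z, In z dom -> ltT s z -> lab s <> lab z;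
  lab_coh : forall x y s t, In x dom -> In y dom -> lev x = lev y ->
    lab x = lab y -> ltT s x -> ltT t y -> lev s = lev t -> lab s = lab t
}.

Definition cle (p q : cond) : Prop :=
  forall x, In x (dom q) -> In x (dom p) /\ lab p x = lab q x.

Definition empty_cond : cond.
Proof.
refine (Cond [] (fun _ => 0) _ _ _).
- exists 1; auto.
- intros s z [].
- intros x y s t [].
Defined.

Lemma cle_refl p : cle p p.
Proof. now intros x Hx. Qed.

Lemma cle_trans p q r : cle p q -> cle q r -> cle p r.
Proof.
intros pq qr x Hx; destruct (qr x Hx) as [Hq Eq]; destruct (pq x Hq) as [Hp Ep].
split; congruence.
Qed.

(** The agreement that coherence demands of two equally labelled nodes on one level, stated for
    arbitrary nodes so that it is an equivalence relation on all of [T]. *)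
Definition sim (E : T -> nat) (s t : T) : Prop :=
  lev s = lev t /\ E s = E t /\
  forall s' t', ltT s' s -> ltT t' t -> lev s' = lev t' -> E s' = E t'.

Lemma sim_sym E s t : sim E s t -> sim E t s.
Proof.
intros [H1 [H2 H3]]; repeat split; auto.
intros s' t' Hs Ht He; symmetry; apply H3; auto.
Qed.

Lemma sim_trans E s t r : sim E s t -> sim E t r -> sim E s r.
Proof.
intros [H1 [H2 H3]] [G1 [G2 G3]]; repeat split; try congruence.
intros s' r' Hs Hr He.
destruct (pred_transfer s' s t Hs H1) as [t' [Ht Et]].
rewrite (H3 s' t'); auto; apply G3; congruence.
Qed.

Lemma coh_sim p x y s t : In x (dom p) -> In y (dom p) -> lev x = lev y ->
  lab p x = lab p y -> ltT s x -> ltT t y -> lev s = lev t -> sim (lab p) s t.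
Proof.
intros Hx Hy El E sx ty e; repeat split; auto.
- now apply (lab_coh p x y).
- intros s' t' Hs Ht; apply (lab_coh p x y); auto; eapply ltT_trans; eauto.
Qed.

(* If [x] looks like an element of the domain it inherits its label; otherwise
   its whole [sim]-class is relabelled, which keeps the labels coherent. *)
Lemma add_node p x : exists q, cle q p /\ dom q = x :: dom p.
Proof.
destruct (classic (exists y, In y (dom p) /\ sim (lab p) x y)) as [[y [Hy xy]]|nE].
(* Each node of the enlarged domain has a representative in [dom p], through which the chain and
   coherence clauses of [p] transfer. *)
- assert (rep : forall z, In z (x :: dom p) ->
    exists y, In y (dom p) /\ sim (lab p) z y).
  { intros z [<-|Hz]; [eauto|].
    exists z; repeat split; auto; intros s' t' Hs Ht e.
    f_equal; eapply pred_unique; eauto. }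
  unshelve refine (ex_intro _ (Cond (x :: dom p) (lab p) (lab_bound p) _ _) _).
  + intros s z Hz sz; destruct (rep z Hz) as [w [Hw [El [E H]]]].
    destruct (pred_transfer s z w sz El) as [s' [Hs e]].
    rewrite E, (H s s'); auto; now apply lab_chain.
  + intros z w s t Hz Hw El E sz tw e.
    destruct (rep z Hz) as [z' [Hz' [Elz [Ez Hzz]]]].
    destruct (rep w Hw) as [w' [Hw' [Elw [Ew Hww]]]].
    destruct (pred_transfer s z z' sz Elz) as [s' [Hs es]].
    destruct (pred_transfer t w w' tw Elw) as [t' [Ht et]].
    rewrite (Hzz s s'), (Hww t t'); auto.
    apply (lab_coh p z' w'); congruence.
  + split; [|reflexivity]; intros z Hz; simpl; auto.
- destruct (lab_bound p) as [N HN].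
  (* [N] bounds all labels of [p] strictly, so it is a fresh label. *)
  pose (E := fun s => if excluded_middle_informative (sim (lab p) s x)
                      then N else lab p s).
  assert (Ex : forall s, sim (lab p) s x -> E s = N).
  { intros s H; unfold E; destruct excluded_middle_informative; tauto. }
  assert (En : forall s, ~ sim (lab p) s x -> E s = lab p s).
  { intros s H; unfold E; destruct excluded_middle_informative; tauto. }
  assert (Exx : E x = N).
  { apply Ex; repeat split; intros s t sx tx e; f_equal; eapply pred_unique; eauto. }
  assert (Eu : forall z, In z (dom p) -> E z = lab p z).
  { intros z Hz; apply En; intros H; apply nE; exists z; split; auto.
    now apply sim_sym. }
  unshelve refine (ex_intro _ (Cond (x :: dom p) E _ _ _) _).
  + exists (S N); intros t; specialize (HN t); unfold E; destruct excluded_middle_informative; lia.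
  + intros s z [<-|Hz] sz.
    * rewrite Exx, En; [specialize (HN s); lia|].
      intros [El _]; apply lev_lt in sz; rewrite El in sz; exact (ltW_irrefl _ sz).
    * rewrite (Eu z Hz); destruct (classic (sim (lab p) s x)) as [H|H].
      -- rewrite (Ex s H); specialize (HN z); lia.
      -- rewrite (En s H); now apply lab_chain.
  + intros z w s t Hz Hw El Ezw sz tw e.
    destruct Hz as [<-|Hz], Hw as [<-|Hw].
    * f_equal; eapply pred_unique; eauto.
    * rewrite Exx, (Eu w Hw) in Ezw; specialize (HN w); lia.
    * rewrite Exx, (Eu z Hz) in Ezw; specialize (HN z); lia.
    * rewrite (Eu z Hz), (Eu w Hw) in Ezw.
      (* Being in one [sim]-class, [s] and [t] are either both relabelled or both left alone. *)
      assert (st : sim (lab p) s t) by (apply (coh_sim p z w); auto).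
      destruct (classic (sim (lab p) t x)) as [H|H].
      -- rewrite (Ex t H); apply Ex; eapply sim_trans; eauto.
      -- rewrite (En t H), En; [exact (proj1 (proj2 st))|].
         intros H'; apply H; eapply sim_trans; eauto; now apply sim_sym.
  + split; [|reflexivity]; intros z Hz; simpl; auto.
Qed.

Lemma add_nodes p v : exists q, cle q p /\ dom q = v ++ dom p.
Proof.
induction v as [|x v [q [qp Dq]]].
- exists p; split; auto using cle_refl.
- destruct (add_node q x) as [r [rq Dr]].
  exists r; split; [eapply cle_trans; eauto|]; simpl; congruence.
Qed.

(** Makes membership in [u] of a predecessor of a node of [u] depend on its level alone; this is why
    one junk label outside the domains stays coherent in [amalgamation]. *)
Definition closed (u : list T) : Prop :=
  forall x y s, In x u -> In y u -> ltT s x -> lev s = lev y -> In s u.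

(** Finiteness holds because a node has at most one predecessor on a given level. *)
Lemma restrictions_list (u v : list T) : exists w, forall s,
  In s w <-> exists x y, In x u /\ In y v /\ ltT s x /\ lev s = lev y.
Proof.
induction u as [|x u [w Hw]].
{ exists []; intros s; split; [intros []|intros [x [y [[] _]]]]. }
assert (H : exists w', forall s,
  In s w' <-> exists y, In y v /\ ltT s x /\ lev s = lev y).
{ clear w Hw; induction v as [|y v [w Hw]].
  - exists []; intros s; split; [intros []|intros [y [[] _]]].
  - destruct (classic (exists r, ltT r x /\ lev r = lev y)) as [[r [rx ry]]|nE].
    + exists (r :: w); intros s; split.
      * intros [<-|Hs]; [exists y; simpl; auto|].
        apply Hw in Hs; destruct Hs as [z [Hz H]]; exists z; simpl; auto.
      * intros [z [[<-|Hz] [sx sz]]].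
        -- left; eapply pred_unique; eauto; congruence.
        -- right; apply Hw; eauto.
    + exists w; intros s; split.
      * intros Hs; apply Hw in Hs; destruct Hs as [z [Hz H]]; exists z; simpl; auto.
      * intros [z [[<-|Hz] [sx sz]]]; [exfalso; eauto|apply Hw; eauto]. }
destruct H as [w' Hw'].
exists (w' ++ w); intros s; rewrite in_app_iff, Hw, Hw'; split.
- intros [[y [Hy H]]|[z [y [Hz H]]]]; [exists x, y|exists z, y]; simpl; tauto.
- intros [z [y [[<-|Hz] H]]]; [left; exists y|right; exists z, y]; tauto.
Qed.

(** One round of adding restrictions suffices: it creates no new levels, and a restriction of a
    restriction is a restriction of the original node. *)
Lemma close_cond p : exists q, cle q p /\ closed (dom q).
Proof.
destruct (restrictions_list (dom p) (dom p)) as [w Hw].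
destruct (add_nodes p w) as [q [qp Dq]].
exists q; split; auto; rewrite Dq.
assert (lv : forall y, In y (w ++ dom p) ->
  exists y', In y' (dom p) /\ lev y = lev y').
{ intros y Hy; apply in_app_iff in Hy; destruct Hy as [Hy|Hy]; [|eauto].
  apply Hw in Hy; destruct Hy as [x [z H]]; exists z; tauto. }
intros x y s Hx Hy sx sy; apply in_app_iff; left; apply Hw.
destruct (lv y Hy) as [y' [Hy' E]].
apply in_app_iff in Hx; destruct Hx as [Hx|Hx].
- apply Hw in Hx; destruct Hx as [z [z' [Hz [_ [xz _]]]]].
  exists z, y'; repeat split; auto; [eapply ltT_trans; eauto|congruence].
- exists x, y'; repeat split; auto; congruence.
Qed.

(* The labelling is [lab p] on [dom p], [lab q] on [dom q], and one fresh junk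
   value elsewhere.  The levels common to [p] and [q] form the root: the other
   levels of [q] lie above all levels of [p], and below a root level [p] has
   only root levels.  The primed nodes are the copies in [p] of nodes of [q]. *)
Lemma amalgamation p q :
  closed (dom p) -> closed (dom q) ->
  (forall y, In y (dom q) -> (exists x, In x (dom p) /\ lev x = lev y) \/
     (forall x, In x (dom p) -> ltW (lev x) (lev y))) ->
  (forall x y z, In x (dom p) -> In y (dom q) -> In z (dom p) ->
     lev z = lev y -> ltW (lev x) (lev z) ->
     exists w, In w (dom q) /\ lev w = lev x) ->
  (forall x y, In x (dom p) -> In y (dom q) -> ltT x y ->
     exists w, In w (dom q) /\ lev w = lev x) ->
  (forall y x, In y (dom q) -> In x (dom p) -> lev x = lev y ->
     exists y', In y' (dom p) /\ lev y' = lev y /\ lab p y' = lab q y /\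
       (In y (dom p) -> y' = y) /\
       forall z, In z (dom q) -> ltT z y ->
         exists z', In z' (dom p) /\ ltT z' y' /\ lev z' = lev z /\
           lab p z' = lab q z) ->
  compatible cle p q.
Proof.
intros clp clq h1 h2 h3 h0.
destruct (lab_bound p) as [Np HNp]; destruct (lab_bound q) as [Nq HNq].
(* Exceeds every label of [p] and [q], so a junk predecessor never shares its label with a node of
   the domains. *)
pose (N := Np + Nq).
pose (E := fun s => if excluded_middle_informative (In s (dom p)) then lab p s
  else if excluded_middle_informative (In s (dom q)) then lab q s else N).
assert (Ep : forall s, In s (dom p) -> E s = lab p s).
{ intros s Hs; unfold E; destruct excluded_middle_informative; tauto. }
assert (Eq : forall s, In s (dom q) -> E s = lab q s).
{ intros s Hs; unfold E; destruct excluded_middle_informative as [Hp|].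
  - destruct (h0 s s Hs Hp eq_refl) as [y' [_ [_ [H [H' _]]]]].
    now rewrite (H' Hp) in H.
  - destruct excluded_middle_informative; tauto. }
assert (En : forall s, ~ In s (dom p ++ dom q) -> E s = N).
{ intros s Hs; rewrite in_app_iff in Hs; unfold E.
  destruct excluded_middle_informative; [tauto|].
  destruct excluded_middle_informative; tauto. }
(* No node of one domain slips below the other from outside: such a node lies on a level of both
   domains, where closedness captures it, or above all levels of [p]. *)
assert (downp : forall s z, In z (dom p) -> ltT s z ->
  In s (dom p ++ dom q) -> In s (dom p)).
{ intros s z Hz sz Hs; apply in_app_iff in Hs; destruct Hs as [|Hs]; auto.
  destruct (h1 s Hs) as [[x [Hx e]]|H].
  - apply (clp z x s); auto.
  - exfalso; exact (ltW_asym _ _ (H z Hz) (lev_lt _ _ sz)). }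
assert (downq : forall s z, In z (dom q) -> ltT s z ->
  In s (dom p ++ dom q) -> In s (dom q)).
{ intros s z Hz sz Hs; apply in_app_iff in Hs; destruct Hs as [Hs|]; auto.
  destruct (h3 s z Hs Hz sz) as [w [Hw e]]; apply (clq z w s); auto. }
assert (same : forall s t, (In s (dom p ++ dom q) <-> In t (dom p ++ dom q)) ->
  (In s (dom p ++ dom q) -> In t (dom p ++ dom q) -> E s = E t) -> E s = E t).
{ intros s t st H; destruct (classic (In s (dom p ++ dom q))) as [Hs|Hs].
  - apply H; tauto.
  - rewrite (En s), (En t); tauto. }
assert (inp : forall s, In s (dom p) -> In s (dom p ++ dom q)).
{ intros; apply in_app_iff; auto. }
assert (inq : forall s, In s (dom q) -> In s (dom p ++ dom q)).
{ intros; apply in_app_iff; auto. }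
(* The node [y] of [q] and its predecessor are replaced by their copies in [p], and coherence of [p]
   applies. *)
assert (mixed : forall x y s t, In x (dom p) -> In y (dom q) -> lev x = lev y ->
  E x = E y -> ltT s x -> ltT t y -> lev s = lev t -> E s = E t).
{ intros x y s t Hx Hy El Exy sx ty e.
  assert (st : In s (dom p) -> In t (dom q)).
  { intros Hs; destruct (h2 s y x Hs Hy Hx El (lev_lt _ _ sx)) as [w [Hw e']].
    apply (clq y w t); auto; congruence. }
  assert (ts : In t (dom q) -> In s (dom p)).
  { intros Ht; destruct (h1 t Ht) as [[w [Hw e']]|H].
    - apply (clp x w s); auto; congruence.
    - exfalso; apply (ltW_asym _ _ (H x Hx)); rewrite El; now apply lev_lt. }
  apply same.
  - split; intros H; [apply inq, st, (downp s x)|apply inp, ts, (downq t y)]; auto.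
  - intros Hs _; apply (downp s x) in Hs; auto; specialize (st Hs).
    destruct (h0 y x Hy Hx El) as [y' [Hy' [El' [Ey' [_ H]]]]].
    destruct (H t st ty) as [t' [Ht' [ty' [elt Et']]]].
    rewrite (Ep s Hs), (Eq t st), <- Et'.
    rewrite (Ep x Hx), (Eq y Hy) in Exy.
    apply (lab_coh p x y'); congruence. }
unshelve refine (ex_intro _ (Cond (dom p ++ dom q) E _ _ _) _).
- exists (S N); intros t; unfold E, N; specialize (HNp t); specialize (HNq t).
  repeat destruct excluded_middle_informative; lia.
- intros s z Hz sz.
  destruct (classic (In s (dom p ++ dom q))) as [Hs|Hs].
  + apply in_app_iff in Hz; destruct Hz as [Hz|Hz].
    * apply (downp s z) in Hs; auto; rewrite (Ep s), (Ep z); auto.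
      now apply lab_chain.
    * apply (downq s z) in Hs; auto; rewrite (Eq s), (Eq z); auto.
      now apply lab_chain.
  + rewrite (En s Hs); unfold N; specialize (HNp z); specialize (HNq z).
    apply in_app_iff in Hz; destruct Hz as [Hz|Hz];
      rewrite ?(Ep z Hz), ?(Eq z Hz); lia.
- intros x y s t Hx Hy El Exy sx ty e.
  apply in_app_iff in Hx; apply in_app_iff in Hy.
  destruct Hx as [Hx|Hx], Hy as [Hy|Hy].
  + apply same.
    * split; intros H; apply inp.
      -- apply (clp y s t); auto; apply (downp s x); auto.
      -- apply (clp x t s); auto; apply (downp t y); auto.
    * intros Hs Ht; apply (downp s x) in Hs; apply (downp t y) in Ht; auto.
      rewrite (Ep s), (Ep t); auto; rewrite (Ep x), (Ep y) in Exy; auto.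
      now apply (lab_coh p x y).
  + apply (mixed x y); auto.
  + symmetry; apply (mixed y x); auto.
  + apply same.
    * split; intros H; apply inq.
      -- apply (clq y s t); auto; apply (downq s x); auto.
      -- apply (clq x t s); auto; apply (downq t y); auto.
    * intros Hs Ht; apply (downq s x) in Hs; apply (downq t y) in Ht; auto.
      rewrite (Eq s), (Eq t); auto; rewrite (Eq x), (Eq y) in Exy; auto.
      now apply (lab_coh q x y).
- split; intros z Hz; simpl; auto.
Qed.

(** * The countable chain condition *)

Lemma cond_ccc : no_uncountable_branch ltT -> ccc cle.
Proof.
intros nb A anti; apply NNPP; intros nA.
(* If [T] is empty, any two conditions are compatible; otherwise [t0] is the default value for
   [nth]. *)
destruct (classic (inhabited T)) as [[t0]|nT].
2: { destruct (uncountable_pair A nA) as [p [q [Ap [Aq pq]]]].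
  apply (anti p q Ap Aq pq).
  exists p; split; intros x; destruct (nT (inhabits x)). }
pose (cl := fun p => proj1_sig (constructive_indefinite_description _ (close_cond p))).
assert (cl_le : forall p, cle (cl p) p).
{ intros p; apply (proj2_sig (constructive_indefinite_description _ (close_cond p))). }
assert (cl_closed : forall p, closed (dom (cl p))).
{ intros p; apply (proj2_sig (constructive_indefinite_description _ (close_cond p))). }
clearbody cl.
pose (nd := fun k p => nth k (dom (cl p)) t0).
destruct (thin_family_nat (fun _ : unit => fun p => length (dom (cl p))) [tt] A nA)
  as [A1 [A1A [nA1 len]]].
destruct (uncountable_pair A1 nA1) as [p0 [_ [Ap0 _]]].
pose (idx := seq 0 (length (dom (cl p0)))).
assert (in_dom : forall k p, In k idx -> A1 p -> In (nd k p) (dom (cl p))).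
{ intros k p Hk Ap; apply nth_In; apply in_seq in Hk.
  rewrite (len tt p p0); simpl; auto; lia. }
assert (dom_in : forall x p, A1 p -> In x (dom (cl p)) ->
  exists k, In k idx /\ x = nd k p).
{ intros x p Ap Hx; apply (In_nth _ _ t0) in Hx; destruct Hx as [k [Hk E]].
  exists k; split; auto; apply in_seq; rewrite (len tt p0 p); simpl; auto; lia. }
clearbody idx; clear len p0 Ap0.
destruct (thin_family_nat (fun k p => lab (cl p) (nd k p)) idx A1 nA1)
  as [A2 [A2A [nA2 labE]]].
destruct (thin_family_nat (fun kl p =>
    if excluded_middle_informative (ltT (nd (fst kl) p) (nd (snd kl) p))
    then 1 else 0) (list_prod idx idx) A2 nA2)
  as [A3 [A3A [nA3 ltE']]].
assert (ltE : forall k l p q, In k idx -> In l idx -> A3 p -> A3 q ->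
  ltT (nd k p) (nd l p) -> ltT (nd k q) (nd l q)).
{ intros k l p q Hk Hl Ap Aq H.
  specialize (ltE' (k, l) p q (in_prod _ _ _ _ Hk Hl) Ap Aq); simpl in ltE'.
  do 2 destruct excluded_middle_informative; congruence || tauto. }
clear ltE'.
(* Domain size, labels and tree order are now uniform across positions; next each node, then each
   level, becomes constant or countable-to-one. *)
destruct (thin_family nd idx A3 nA3) as [A4 [A4A [nA4 ndE]]].
destruct (thin_family (fun k p => lev (nd k p)) idx A4 nA4)
  as [B [BA4 [nB levE']]].
(* [Lc k]: the [k]-th nodes of the conditions in [B] lie on a fixed (root) level. *)
pose (Lc := fun k => exists a, forall p, B p -> lev (nd k p) = a).
assert (levE : forall k a, In k idx -> ~ Lc k ->
  countable (fun p => B p /\ ~ ltW a (lev (nd k p)))).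
{ intros k a Hk nk.
  apply (countable_preimage B (fun p => lev (nd k p)) (fun b => ~ ltW a b)).
  { apply countable_not_above. }
  intros b _; destruct (levE' k Hk) as [H|H]; [contradiction|auto]. }
assert (levF : forall k x, In k idx -> ~ Lc k ->
  countable (fun p => B p /\ nd k p = x)).
{ intros k x Hk nk; destruct (levE' k Hk) as [H|H]; [contradiction|].
  apply countable_sub with (2 := H (lev x)); intros p [Bp <-]; auto. }
clear levE'.
(* Only countably many conditions are lost by requiring root levels to lie below all other
   levels. *)
pose (C := fun p => B p /\ forall k l, In k idx -> In l idx -> Lc k -> ~ Lc l ->
  ltW (lev (nd k p)) (lev (nd l p))).
assert (nC : ~ countable C).
{ intros HC; apply nB.
  apply countable_sub with (fun p => C p \/ exists kl, In kl (list_prod idx idx) /\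
    (B p /\ Lc (fst kl) /\ ~ Lc (snd kl) /\
     ~ ltW (lev (nd (fst kl) p)) (lev (nd (snd kl) p)))).
  - intros p Bp; apply NNPP; intros H; apply H; left; split; auto.
    intros k l Hk Hl ck cl'; apply NNPP; intros nlt; apply H; right.
    exists (k, l); split; [now apply in_prod|]; simpl; auto.
  - apply countable_union; auto; apply countable_bigcup; [apply countable_list|].
    intros [k l] Hkl; simpl; apply in_prod_iff in Hkl.
    destruct (classic (Lc k /\ ~ Lc l)) as [[[a Ha] nl]|nE].
    + apply countable_sub with (2 := levE l a (proj2 Hkl) nl).
      intros p [Bp [_ [_ H]]]; rewrite (Ha p Bp) in H; auto.
    + exists (fun _ => 0); intros p q [_ [H [H' _]]]; tauto. }
assert (CB : forall p, C p -> B p) by (intros p []; auto).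
assert (CA3 : forall p, C p -> A3 p) by (intros p []; auto).
assert (CA1 : forall p, C p -> A1 p) by (intros p []; auto).
assert (LcE : forall k p q, Lc k -> C p -> C q -> lev (nd k p) = lev (nd k q)).
{ intros k p q [a Ha] [Bp _] [Bq _]; now rewrite !Ha. }
destruct (uniform_ultrafilter C nC) as [U [Ubig [Uint Ufin]]].
(* For all but countably many [j], incompatibility with [i] forces a non-root node of [i] below a
   node of [j]; primeness of [U] then fixes the two positions. *)
assert (key : forall i, C i -> exists kl, In kl (list_prod idx idx) /\
  U (fun j => ~ Lc (fst kl) /\ ltT (nd (fst kl) i) (nd (snd kl) j))).
{ intros i Ci; apply Ufin, Ubig.
  (* The exceptional [j]: [i] itself, those with a non-root node not on a higher level than every
     node of [i], and those sharing with [i] a node at a position that is not constant. *)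
  apply countable_sub with (fun j => j = i \/
    ((exists kl, In kl (list_prod idx idx) /\ (~ Lc (snd kl) /\ B j /\
       ~ ltW (lev (nd (fst kl) i)) (lev (nd (snd kl) j)))) \/
     (exists kl, In kl (list_prod idx idx) /\
       ((exists j', B j' /\ nd (snd kl) j' <> nd (snd kl) i) /\ B j /\
       nd (snd kl) j = nd (fst kl) i)))).
  2: { apply countable_union; [apply countable_eq|].
    apply countable_union; apply countable_bigcup; try apply countable_list;
      intros [k l] Hkl; simpl; apply in_prod_iff in Hkl.
    - destruct (classic (Lc l)) as [c|nc].
      + exists (fun _ => 0); intros p q [H _]; tauto.
      + apply countable_sub with (2 := levE l (lev (nd k i)) (proj2 Hkl) nc); tauto.
    - destruct (ndE l (proj2 Hkl)) as [[y Hy]|H].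
      + exists (fun _ => 0); intros p q [[j' [Bj' H]] _]; exfalso; apply H.
        rewrite !Hy; auto.
      + apply countable_sub with (2 := H (nd k i)); intros j [_ [Bj E]]; auto. }
  intros j [Cj nj]; apply NNPP; intros good.
  assert (ij : i <> j) by (intros ->; apply good; auto).
  assert (above : forall k l, In k idx -> In l idx -> ~ Lc l ->
    ltW (lev (nd k i)) (lev (nd l j))).
  { intros k l Hk Hl nl; apply NNPP; intros H; apply good; right; left.
    exists (k, l); split; [now apply in_prod|]; simpl; auto. }
  assert (root : forall k l, In k idx -> In l idx -> nd l j = nd k i ->
    nd l j = nd l i).
  { intros k l Hk Hl E; apply NNPP; intros H; apply good; right; right.
    exists (k, l); split; [now apply in_prod|]; simpl; split; [|auto].
    exists j; auto. }
  assert (lowc : forall k l, In k idx -> In l idx -> lev (nd k i) = lev (nd l j) ->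
    Lc l).
  { intros k l Hk Hl E; apply NNPP; intros nl; apply (ltW_irrefl (lev (nd l j))).
    rewrite <- E at 1; auto. }
  assert (belowc : forall k l, In k idx -> In l idx -> Lc l ->
    ltW (lev (nd k i)) (lev (nd l i)) -> Lc k).
  { intros k l Hk Hl cl' H; apply NNPP; intros nk.
    destruct Ci as [_ Ci]; exact (ltW_asym _ _ H (Ci l k Hl Hk cl' nk)). }
  clear good.
  apply (anti i j); auto.
  assert (compat : compatible cle (cl i) (cl j)).
  2: { destruct compat as [r [ri rj]]; exists r; split;
         [apply (cle_trans _ (cl i))|apply (cle_trans _ (cl j))]; auto. }
  apply amalgamation; auto.
  - intros y Hy; apply dom_in in Hy; auto; destruct Hy as [l [Hl ->]].
    destruct (classic (Lc l)) as [c|nc].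
    + left; exists (nd l i); split; auto.
    + right; intros x Hx; apply dom_in in Hx; auto; destruct Hx as [k [Hk ->]]; auto.
  - intros x y z Hx Hy Hz E H.
    apply dom_in in Hx; auto; destruct Hx as [k [Hk ->]].
    apply dom_in in Hy; auto; destruct Hy as [l [Hl ->]].
    apply dom_in in Hz; auto; destruct Hz as [m [Hm ->]].
    assert (c : Lc l) by eauto.
    exists (nd k j); split; auto; apply LcE; auto.
    apply (belowc k l); auto; rewrite (LcE l i j); auto; congruence.
  - intros x y Hx Hy xy.
    apply dom_in in Hx; auto; destruct Hx as [k [Hk ->]].
    apply dom_in in Hy; auto; destruct Hy as [l [Hl ->]].
    exists (nd k j); split; auto; apply LcE; auto.
    (* The only use of the assumption that no non-root node of [i] lies below a node of [j]. *)
    apply NNPP; intros nk; apply nj.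
    exists (k, l); split; [now apply in_prod|]; auto.
  - intros y x Hy Hx E.
    apply dom_in in Hx; auto; destruct Hx as [m [Hm ->]].
    apply dom_in in Hy; auto; destruct Hy as [l [Hl ->]].
    assert (c : Lc l) by eauto.
    (* The copy of a node of [j] is the node of [i] at the same position; uniform labels and order
       make it faithful. *)
    exists (nd l i); repeat split; auto.
    + intros Hp; apply dom_in in Hp; auto; destruct Hp as [k [Hk Ek]].
      symmetry; eauto.
    + intros z Hz zy; apply dom_in in Hz; auto; destruct Hz as [k [Hk ->]].
      assert (zy' : ltT (nd k i) (nd l i)) by (apply (ltE k l j i); auto).
      exists (nd k i); repeat split; auto.
      apply LcE; auto; apply (belowc k l); auto; now apply lev_lt. }
assert (pick : exists k l, In k idx /\
  ~ countable (fun i => C i /\ U (fun j => ~ Lc k /\ ltT (nd k i) (nd l j)))).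
{ apply NNPP; intros nE; apply nC.
  apply countable_sub with (fun i => exists kl, In kl (list_prod idx idx) /\
    (C i /\ U (fun j => ~ Lc (fst kl) /\ ltT (nd (fst kl) i) (nd (snd kl) j)))).
  { intros i Ci; destruct (key i Ci) as [kl H]; exists kl; tauto. }
  apply countable_bigcup; [apply countable_list|].
  intros [k l] Hkl; simpl; apply in_prod_iff in Hkl.
  apply NNPP; intros nc; apply nE; exists k, l; tauto. }
destruct pick as [k [l [Hk nD]]].
assert (nk : ~ Lc k).
{ destruct (uncountable_pair _ nD) as [i [_ [[_ Ui] _]]].
  destruct (Uint _ _ Ui Ui) as [j [[H _] _]]; auto. }
apply nD.
(* Two members of [K] lie below one node [nd l j], as two sets in [U] meet; hence [K] is a chain. *)
pose (K := fun x => exists i, U (fun j => ~ Lc k /\ ltT (nd k i) (nd l j)) /\ nd k i = x).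
assert (cK : countable K).
{ apply (countable_chain nb); intros x y [i [Ui <-]] [i' [Ui' <-]].
  destruct (Uint _ _ Ui Ui') as [j [[_ H] [[_ H'] _]]].
  destruct treeT as [_ [_ lin]]; exact (lin _ _ _ H H'). }
(* Position [k] is not a root position, so [nd k] is countable-to-one and pulls the countable [K]
   back to a countable set. *)
apply countable_sub with (fun i => B i /\ K (nd k i)).
{ intros i [[Bi _] Ui]; split; auto; exists i; auto. }
apply (countable_preimage _ (nd k) K cK); auto.
Qed.

Lemma cond_forcing_notion : forcing_notion cond cle.
Proof.
split; [exact (inhabits empty_cond)|split].
- exact cle_refl.
- exact cle_trans.
Qed.

(** * The Aronszajn tree *)

Definition coherent_specialization (e : T -> nat) : Prop :=
  (forall s t, ltT s t -> e s <> e t) /\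
  (forall x y s t, lev x = lev y -> e x = e y -> ltT s x -> ltT t y ->
     lev s = lev t -> e s = e t).

(** Directedness of [G] makes the label of a node independent of the condition it is read from, and
    puts any four nodes into one domain, where the clauses of a condition apply. *)
Lemma generic_coherent_specialization (G : cond -> Prop) :
  filter cle G -> (forall x, exists p, G p /\ In x (dom p)) ->
  exists e, coherent_specialization e.
Proof.
intros [_ [_ dir]] tot.
pose (e := fun x => epsilon (inhabits 0)
  (fun n => exists p, G p /\ In x (dom p) /\ lab p x = n)).
assert (He : forall x, exists p, G p /\ In x (dom p) /\ lab p x = e x).
{ intros x; apply (epsilon_spec (inhabits 0)
    (fun n => exists p, G p /\ In x (dom p) /\ lab p x = n)).
  destruct (tot x) as [p [Gp Hp]]; exists (lab p x), p; auto. }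
assert (Ee : forall p x, G p -> In x (dom p) -> e x = lab p x).
{ intros p x Gp Hx; destruct (He x) as [q [Gq [Hq <-]]].
  destruct (dir p q Gp Gq) as [r [_ [rp rq]]].
  transitivity (lab r x); [symmetry; now apply rq|now apply rp]. }
assert (common : forall x y, exists p, G p /\ In x (dom p) /\ In y (dom p)).
{ intros x y; destruct (tot x) as [p [Gp Hp]]; destruct (tot y) as [q [Gq Hq]].
  destruct (dir p q Gp Gq) as [r [Gr [rp rq]]].
  exists r; split; [auto|split; [now apply rp|now apply rq]]. }
exists e; split.
- intros s t st; destruct (common s t) as [p [Gp [Hs Ht]]].
  rewrite (Ee p s), (Ee p t); auto; now apply lab_chain.
- intros x y s t El E sx ty e'.
  destruct (common x y) as [p [Gp [Hx Hy]]].
  destruct (common s t) as [q [Gq [Hs Ht]]].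
  destruct (dir p q Gp Gq) as [r [Gr [rp rq]]].
  apply rp in Hx, Hy; apply rq in Hs, Ht.
  destruct Hx as [Hx _], Hy as [Hy _], Hs as [Hs _], Ht as [Ht _].
  rewrite (Ee r x), (Ee r y) in E; auto.
  rewrite (Ee r s), (Ee r t); auto; now apply (lab_coh r x y).
Qed.

Lemma aronszajn_of_coherent_specialization (e : T -> nat) :
  coherent_specialization e ->
  exists (S : Type) (ltS : S -> S -> Prop) (f : T -> S),
    aronszajn W ltW S ltS /\ weak_embedding ltT ltS f.
Proof.
intros [spec coh].
(* The quotient of [T], realised as the set of attained pairs of level and label. *)
pose (S := {an : W * nat | exists t, an = (lev t, e t)}).
pose (pi := fun t : T => (exist _ (lev t, e t) (ex_intro _ t eq_refl)) : S).
assert (pi_onto : forall a, exists t, a = pi t).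
{ intros [an [t E]]; exists t; subst an; reflexivity. }
assert (pi_eq : forall s t, lev s = lev t -> e s = e t -> pi s = pi t).
{ intros s t E1 E2; apply subset_eq_compat; congruence. }
assert (pi_inv : forall s t, pi s = pi t -> lev s = lev t /\ e s = e t).
{ intros s t E; apply (f_equal (@proj1_sig _ _)) in E; simpl in E.
  split; congruence. }
pose (ltS := fun a b => exists s t, ltT s t /\ pi s = a /\ pi t = b).
(* Coherence lifts predecessors of [pi s] to predecessors of the given representative [s], so the
   tree axioms descend from [T]. *)
assert (below : forall s b, ltS b (pi s) -> exists t, ltT t s /\ pi t = b).
{ intros s b [t [s' [ts' [<- E]]]]; apply pi_inv in E; destruct E as [E1 E2].
  destruct (pred_transfer t s' s ts' E1) as [t' [t's El]].
  exists t'; split; auto; apply pi_eq; auto; symmetry; apply (coh s' s); auto. }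
exists S, ltS, pi; split; [|intros s t st; exists s, t; auto].
split; [split; [|split]|split].
- intros a [s [t [st [<- E]]]]; apply pi_inv in E; destruct E as [E _].
  apply lev_lt in st; rewrite E in st; exact (ltW_irrefl _ st).
- intros a b c ab bc; destruct (pi_onto c) as [r ->].
  apply below in bc; destruct bc as [s [sr <-]].
  apply below in ab; destruct ab as [t [ts <-]].
  exists t, r; eauto using ltT_trans.
- intros c a b ac bc; destruct (pi_onto c) as [r ->].
  apply below in ac; destruct ac as [s [sr <-]].
  apply below in bc; destruct bc as [t [tr <-]].
  destruct treeT as [_ [_ lin]]; destruct (lin r s t sr tr) as [->|[H|H]]; auto.
  + right; left; exists s, t; auto.
  + right; right; exists t, s; auto.
- exists (fun a => fst (proj1_sig a)); split; [split; [|split]|].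
  + intros a b [s [t [st [<- <-]]]]; simpl; now apply lev_lt.
  + intros b a; destruct (pi_onto b) as [t ->]; simpl; intros H.
    destruct levT as [_ [dn _]]; destruct (dn t a H) as [s [st <-]].
    exists (pi s); split; auto; exists s, t; auto.
  + intros a; destruct levT as [_ [_ onto]]; destruct (onto a) as [t <-].
    exists (pi t); auto.
  + intros a; exists (fun b => snd (proj1_sig b)); intros x y.
    destruct (pi_onto x) as [s ->]; destruct (pi_onto y) as [t ->]; simpl.
    intros; apply pi_eq; congruence.
(* The label is injective on every chain of the quotient, since [e] separates comparable nodes of
   [T]. *)
- intros B [chB _]; exists (fun b => snd (proj1_sig b)); intros x y Bx By E.
  destruct (chB x y Bx By) as [|[[s [t [st [<- <-]]]]|[s [t [st [<- <-]]]]]]; auto;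
    exfalso; simpl in E; apply (spec s t st); auto.
Qed.

End Forcing.

(** * The dense sets and the application of Martin's Axiom *)

Theorem theorem5p1 :
  forall (W : Type) (ltW : W -> W -> Prop), is_omega1 W ltW ->
  (forall (T : Type) (ltT : T -> T -> Prop), wide_aronszajn W ltW T ltT ->
     exists (P : Type) (le : P -> P -> Prop) (H : W -> P -> Prop),
       forcing_notion P le /\ ccc le /\ (forall a, dense le (H a)) /\
       forall G : P -> Prop, filter le G -> (forall a, exists p, G p /\ H a p) ->
         exists (Tstar : Type) (ltS : Tstar -> Tstar -> Prop) (f : T -> Tstar),
           aronszajn W ltW Tstar ltS /\ weak_embedding ltT ltS f)
  /\
  (MA_omega1 W ltW ->
   forall (T : Type) (ltT : T -> T -> Prop), wide_aronszajn W ltW T ltT ->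
     exists (Tstar : Type) (ltS : Tstar -> Tstar -> Prop) (f : T -> Tstar),
       aronszajn W ltW Tstar ltS /\ weak_embedding ltT ltS f).
Proof.
intros W ltW omega1W.
assert (main : forall (T : Type) (ltT : T -> T -> Prop), wide_aronszajn W ltW T ltT ->
     exists (P : Type) (le : P -> P -> Prop) (H : W -> P -> Prop),
       forcing_notion P le /\ ccc le /\ (forall a, dense le (H a)) /\
       forall G : P -> Prop, filter le G -> (forall a, exists p, G p /\ H a p) ->
         exists (Tstar : Type) (ltS : Tstar -> Tstar -> Prop) (f : T -> Tstar),
           aronszajn W ltW Tstar ltS /\ weak_embedding ltT ltS f).
{ intros T ltT [treeT [[lev levT] [[enum [enum_inj enum_onto]] nb]]].
  (* The bijection [enum] of [T] with [W] indexes by [W] the dense sets asking that a given node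
     enter the domain. *)
  exists (@cond W T ltT lev), cle, (fun a p => exists x, enum x = a /\ In x (dom p)).
  split; [apply cond_forcing_notion|].
  split; [exact (cond_ccc omega1W treeT levT nb)|split].
  - intros a p; destruct (enum_onto a) as [x Ex].
    destruct (add_node omega1W treeT levT p x) as [q [qp Dq]].
    exists q; split; auto; exists x; split; auto; rewrite Dq; now left.
  - intros G fG meets.
    destruct (generic_coherent_specialization G fG) as [e He].
    + intros x; destruct (meets (enum x)) as [p [Gp [y [E Hy]]]].
      apply enum_inj in E; subst y; eauto.
    + exact (aronszajn_of_coherent_specialization omega1W treeT levT e He). }
split; [exact main|].
intros MA T ltT wT.
destruct (main T ltT wT) as [P [le [H [fP [cP [dH gen]]]]]].
destruct (MA P le fP cP H dH) as [G [fG meets]].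
exact (gen G fG meets).
Qed.
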